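(* Let $a,b,c\in\mathbb{R}$ be such that $a>-1$, $b>-1$ and $c>\max\{0,a-b\}$ and let $\{P_n^{[d]}(x):=P_n^{[d]}(x;a,b,c)\}_{n\in\mathbb{N}}$, $d\in\{0,1\}$, be the monic $2$-orthogonal polynomial sequence with respect to $\overline{\mathcal{W}}^{[d]}(x;a,b,c)$. Then $$x^2\frac{d^3}{dx^3}\left(P_n^{[d]}(x)\right)-x\,\varphi(x)\frac{d^2}{dx^2}\left(P_n^{[d]}(x)\right)+\psi_n^{[d]}(x)\frac{d}{dx}\left(P_n^{[d]}(x)\right)+n\,\epsilon_n^{[d]}P_n^{[d]}(x)=0,$$ where $\varphi(x)=x-(a+b+3)$, $\ \psi_n^{[d]}(x)=\left(\left\lfloor\frac{n+1-d}{2}\right\rfloor-(c+b+2)\right)x+(a+1)(b+1)\ $ and $\ \epsilon_n^{[d]}=c+b+1+\left\lfloor\frac{n+d}{2}\right\rfloor$.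
   Context: $\mathbb{N}=\{0,1,2,\dots\}$. For $\alpha>0$, $\beta\in\mathbb{R}$, $x>0$, the Tricomi function is $\mathbf{U}(\alpha,\beta;x)=\frac{1}{\Gamma(\alpha)}\int_0^\infty t^{\alpha-1}(t+1)^{\beta-\alpha-1}e^{-tx}\,dt$. For $a>-1$, $b>-1$, $c>\max\{0,a-b\}$ and $x>0$ define $$\mathcal{W}(x;a,b,c)=\frac{\Gamma(c+b+1)}{\Gamma(a+1)\Gamma(b+1)}\,e^{-x}x^a\,\mathbf{U}(c,a-b+1;x),\qquad \overline{\mathcal{W}}^{[d]}(x;a,b,c)=\begin{bmatrix}\mathcal{W}(x;a,b,c+d)\\ \mathcal{W}(x;a,b,c+1-d)\end{bmatrix},\quad d\in\{0,1\}.$$ A polynomial sequence $\{P_n\}_{n\in\mathbb{N}}$ ($\deg P_n=n$) is $2$-orthogonal with respect to a vector of weights $(w_0,w_1)$ on $(0,\infty)$ if for all $k,n\in\mathbb{N}$: $\int_0^\infty x^kP_n w_0\,dx=0$ if $n\ge 2k+1$ and $\neq0$ if $n=2k$; and $\int_0^\infty x^kP_n w_1\,dx=0$ if $n\ge 2k+2$ and $\neq 0$ if $n=2k+1$. *)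

(* Defs.v *)
From mathcomp Require Import all_boot all_order all_algebra.
From mathcomp Require Import all_classical all_reals all_analysis.

Set Implicit Arguments.
Unset Strict Implicit.
Unset Printing Implicit Defensive.

Import Order.TTheory GRing.Theory Num.Theory.
Import numFieldNormedType.Exports.

Local Open Scope classical_set_scope.
Local Open Scope ring_scope.

(* The real-valued integrals below are total: the value is meaningful only when
   the integrand is integrable on the open half-line. *)
Definition integral0y {R : realType} (f : R -> R) : R :=
  \int[lebesgue_measure]_(x in `]0, +oo[) f x.

(* Euler's integral, used for z > 0 only. *)
Definition Gamma {R : realType} (z : R) : R :=
  integral0y (fun t => t `^ (z - 1) * expR (- t)).

(* Tricomi's function U(alpha, beta; x), for alpha > 0 and x > 0. *)
Definition tricomiU {R : realType} (alpha beta x : R) : R :=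
  (Gamma alpha)^-1 *
  integral0y (fun t => t `^ (alpha - 1) * (t + 1) `^ (beta - alpha - 1)
                       * expR (- (t * x))).

Definition calW {R : realType} (a b c x : R) : R :=
  Gamma (c + b + 1) / (Gamma (a + 1) * Gamma (b + 1))
  * expR (- x) * x `^ a * tricomiU c (a - b + 1) x.

(* The vector of weights indexed by d in {0, 1}, as the pair of its entries. *)
Definition calWbar {R : realType} (d : nat) (a b c : R) : (R -> R) * (R -> R) :=
  (calW a b (c + d%:R), calW a b (c + 1 - d%:R)).

(* deg P_n = n, since the size of a polynomial is its degree plus one. *)
Definition polynomial_sequence {R : realType} (P : nat -> {poly R}) : Prop :=
  forall n, size (P n) = n.+1.

Definition moment {R : realType} (w : R -> R) (k : nat) (p : {poly R}) : R :=
  integral0y (fun x => x ^+ k * p.[x] * w x).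

(* No integrability is required here: for the weights [calW] all these
   integrals converge absolutely when a > -1, b > -1 and c > max(0, a - b). *)
Definition two_orthogonal {R : realType} (w : (R -> R) * (R -> R))
    (P : nat -> {poly R}) : Prop :=
  polynomial_sequence P /\
  forall k n : nat,
    [/\ (2 * k + 1 <= n)%N -> moment w.1 k (P n) = 0,
        n = (2 * k)%N -> moment w.1 k (P n) <> 0,
        (2 * k + 2 <= n)%N -> moment w.2 k (P n) = 0 &
        n = (2 * k + 1)%N -> moment w.2 k (P n) <> 0].

Definition phi {R : realType} (a b x : R) : R := x - (a + b + 3).

(* For d <= 1 the natural subtraction n + 1 - d does not truncate, and
   [%/] on nat is the floor of the quotient. *)
Definition psi {R : realType} (d n : nat) (a b c x : R) : R :=
  (((n + 1 - d) %/ 2)%N%:R - (c + b + 2)) * x + (a + 1) * (b + 1).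

Definition epsilon {R : realType} (d n : nat) (b c : R) : R :=
  c + b + 1 + ((n + d) %/ 2)%N%:R.

(* Main.v *)
From HB Require Import structures.
Require Import Defs.
From mathcomp Require Import all_boot all_order all_algebra.
From mathcomp Require Import all_classical all_reals all_analysis.
From mathcomp Require Import measurable_realfun ring lra zify.

Import Order.TTheory GRing.Theory Num.Theory.
Import numFieldNormedType.Exports.

Set Implicit Arguments.
Unset Strict Implicit.
Unset Printing Implicit Defensive.

Local Open Scope ring_scope.

(** Writing (z)_k for the rising factorial, the moments of the weight are,
up to a constant factor that does not depend on k,

  int_0^oo x^k W(x; a, b, c) dx = K (a + 1)_k (b + 1)_k / (c + b + 1)_k.

Indeed, exchanging the integral over x with the one that defines Tricomi's
function ([eint0y_tonelli]), the inner integral over x becomes a scaled Gamma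
integral and what remains is a Beta integral over t; the functional equations
of the two integrals give the rising factorials ([moment_calW]).

Both entries of the vector of weights thus have moments of this shape, with
the same numerator and with denominator parameters g = c' + b + 1, where c' is
c + d for the first entry and c + 1 - d for the second. Let
e = c + b + 1 + floor((n + d) / 2) and let Q be the monic multiple of the
terminating series 2F2(-n, e; a + 1, b + 1; x). Since e - g is a natural number
r, pairing x^k Q with a weight gives the alternating sum over j of C(n, j)
times the value at j of a polynomial of degree k + r; it vanishes as an n-th
finite difference as soon as k <= r and k + r < n ([hyp_poly_orthogonal]). For
k in the range prescribed by 2-orthogonality these inequalities hold, so Q
satisfies all the vanishing conditions imposed on P_n. Those conditions form a
triangular system with nonzero diagonal in the basis of the P_m, hence have at
most one monic solution of degree n ([monic_orthogonal_unique]), and P_n = Q.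

Finally the coefficients q_j of Q satisfy the two-term recurrence
(j + 1)(j + 1 + a)(j + 1 + b) q_(j+1) = (j - n)(j + e) q_j, which is the
differential equation read coefficient by coefficient
([hypergeometric_ode]). *)

(** * Rising factorials and alternating binomial sums *)

Definition rising {R : comNzRingType} (x : R) (n : nat) : R :=
  \prod_(i < n) (x + i%:R).

Lemma rising0 {R : comNzRingType} (x : R) : rising x 0 = 1.
Proof. by rewrite /rising big_ord0. Qed.

Lemma risingS {R : comNzRingType} (x : R) n :
  rising x n.+1 = rising x n * (x + n%:R).
Proof. by rewrite /rising big_ord_recr. Qed.

Lemma risingD {R : comNzRingType} (x : R) m n :
  rising x (m + n) = rising x m * rising (x + m%:R) n.
Proof.
elim: n => [|n IHn]; first by rewrite addn0 rising0 mulr1.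
by rewrite addnS !risingS IHn natrD addrA mulrA.
Qed.

Lemma rising_gt0 {R : realFieldType} (x : R) n : 0 < x -> 0 < rising x n.
Proof. by move=> x0; apply: prodr_gt0 => i _; rewrite ltr_wpDr. Qed.

Lemma rising_neq0 {R : realFieldType} (x : R) n : 0 < x -> rising x n != 0.
Proof. by move=> x0; rewrite gt_eqF ?rising_gt0. Qed.

Lemma horner_rising {R : comNzRingType} (x y : R) n :
  (rising ('X + x%:P) n).[y] = rising (y + x) n.
Proof.
rewrite horner_prod; apply: eq_bigr => i _.
by rewrite !hornerE -polyC_natr hornerC.
Qed.

Lemma size_rising {R : idomainType} (x : R) n :
  size (rising ('X + x%:P) n) = n.+1.
Proof.
elim: n => [|n IHn]; first by rewrite rising0 size_poly1.
have X : 'X + x%:P + n%:R = 'X + (x + n%:R)%:P :> {poly R}.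
  by rewrite polyCD polyC_natr addrA.
have nz0 : rising ('X + x%:P) n != 0 by rewrite -size_poly_gt0 IHn.
have nz1 : 'X + (x + n%:R)%:P != 0 :> {poly R}.
  by rewrite -size_poly_gt0 size_XaddC.
by rewrite risingS X size_mul // IHn size_XaddC addn2.
Qed.

(** The leading terms of [p] and of its translate cancel. *)
Lemma size_forward_difference {R : idomainType} (p : {poly R}) n :
  (size p <= n.+1)%N -> (size (p - (p \Po ('X + 1%:P)))%R <= n)%N.
Proof.
move=> szp; have szX : size ('X + 1%:P : {poly R}) = 2 by rewrite size_XaddC.
apply/leq_sizeP => j; rewrite leq_eqVlt coefB => /predU1P[<-|lt_nj].
- have [szn|] := eqVneq (size p) n.+1; last first.
    rewrite neq_ltn ltnS [(n.+1 < _)%N]ltnNge szp orbF => szn.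
    by rewrite !nth_default ?size_comp_poly2 // subr0.
  have -> : (p \Po ('X + 1%:P))`_n = lead_coef (p \Po ('X + 1%:P)).
    by rewrite lead_coefE size_comp_poly2 // szn.
  rewrite lead_coef_comp ?szX // lead_coefXaddC expr1n mulr1 lead_coefE szn.
  exact: subrr.
- by rewrite !nth_default ?size_comp_poly2 ?subr0 // (leq_trans szp).
Qed.

(** An [n]-th finite difference kills polynomials of degree less than [n]: by
Pascal's rule the sum for [n.+1] and [p] is the sum for [n] and the difference
of [p] and its translate, which has smaller degree. *)
Lemma alternating_binomial_sum {R : idomainType} n (p : {poly R}) :
  (size p <= n)%N ->
  \sum_(j < n.+1) (-1) ^+ j * 'C(n, j)%:R * p.[j%:R] = 0.
Proof.
elim: n p => [|n IHn] p szp.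
  move: szp; rewrite leqn0 size_poly_eq0 => /eqP ->.
  by rewrite big_ord1 horner0 mulr0.
apply: etrans (IHn (p - (p \Po ('X + 1%:P))) (size_forward_difference szp)).
under [RHS]eq_bigr => j _ do
  rewrite hornerD hornerN horner_comp hornerD hornerX hornerC natr1 mulrBr.
rewrite sumrB big_ord_recl /= bin0 expr0 mul1r.
under eq_bigr => j _ do rewrite /bump /= add1n binS natrD mulrDr mulrDl.
rewrite big_split /= addrA; congr (_ + _).
- rewrite [RHS]big_ord_recl bin0 expr0 mul1r; congr (_ + _).
  by rewrite big_ord_recr /= bin_small // mulr0 mul0r addr0.
- by rewrite -sumrN; apply: eq_bigr => j _; rewrite exprS !mulN1r !mulNr.
Qed.

(** * Monic terminating hypergeometric polynomials *)

(** The coefficients of the monic multiple of 2F2(-n, e; u, v; x): the sign and the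
binomial coefficient stand for (-n)_j / j!, and the factor that only depends on
n normalises the leading coefficient. *)
Definition hyp_coef {R : fieldType} (e u v : R) n j : R :=
  (-1) ^+ (n + j) * 'C(n, j)%:R
  * (rising u n * rising v n / rising e n)
  * (rising e j / (rising u j * rising v j)).

Definition hyp_poly {R : fieldType} (e u v : R) n : {poly R} :=
  \poly_(j < n.+1) hyp_coef e u v n j.

Section HypPoly.
Variables (R : realFieldType) (e u v : R) (n : nat).
Hypotheses (e0 : 0 < e) (u0 : 0 < u) (v0 : 0 < v).

Lemma coef_hyp_poly j : (hyp_poly e u v n)`_j = hyp_coef e u v n j.
Proof.
rewrite coef_poly; case: ltnP => // lt_nj.
by rewrite /hyp_coef bin_small // mulr0 !mul0r.
Qed.

Lemma hyp_coef_lead : hyp_coef e u v n n = 1.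
Proof.
rewrite /hyp_coef addnn -mul2n exprM sqrrN !expr1n binn !mul1r.
rewrite mulrA divfK ?rising_neq0 // divff // mulf_neq0 ?rising_neq0 //.
Qed.

Lemma hyp_coef_rec j :
  j.+1%:R * (u + j%:R) * (v + j%:R) * hyp_coef e u v n j.+1
  = (j%:R - n%:R) * (e + j%:R) * hyp_coef e u v n j.
Proof.
have bin_rec : j.+1%:R * 'C(n, j.+1)%:R = (n%:R - j%:R) * 'C(n, j)%:R :> R.
  rewrite -natrM; have [le_jn|lt_nj] := leqP j n.
    by rewrite mul_bin_left natrM natrB.
  by rewrite !bin_small ?muln0 ?mulr0 // ltnW.
rewrite /hyp_coef addnS exprS !risingS.
have u1 : u + j%:R != 0 by rewrite gt_eqF // ltr_wpDr.
have v1 : v + j%:R != 0 by rewrite gt_eqF // ltr_wpDr.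
have ru : rising u j != 0 by rewrite rising_neq0.
have rv : rising v j != 0 by rewrite rising_neq0.
set s := (-1) ^+ (n + j); set K := _ / rising e n.
transitivity (- s * (j.+1%:R * 'C(n, j.+1)%:R) * K
  * (rising e j * (e + j%:R)) / (rising u j * rising v j)).
  by field; rewrite u1 v1 ru rv.
by rewrite bin_rec; field; rewrite ru rv.
Qed.

End HypPoly.

(** The sum is what pairing x^k with the polynomial gives for a functional whose
moments are (u)_j (v)_j / (g)_j. The quotient (g + r)_j / (g)_(k+j) is a
polynomial of degree r - k in j because k <= r, and (u)_(k+j) / (u)_j and
(v)_(k+j) / (v)_j both have degree k; the total degree k + r is below n, so the
alternating sum vanishes. *)
Lemma hyp_poly_orthogonal {R : realFieldType} (g u v : R) n k r :
  0 < g -> 0 < u -> 0 < v -> (k <= r)%N -> (k + r < n)%N ->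
  \sum_(j < n.+1) hyp_coef (g + r%:R) u v n j
    * (rising u (k + j) * rising v (k + j) / rising g (k + j)) = 0.
Proof.
move=> g0 u0 v0 le_kr lt_krn.
pose S : {poly R} := rising ('X + u%:P) k * rising ('X + v%:P) k
  * rising ('X + (g + k%:R)%:P) (r - k).
have szS : (size S <= n)%N.
  rewrite !size_mul ?mulf_neq0 // -?size_poly_gt0 ?size_rising //.
  by lia.
have e0 : 0 < g + r%:R by rewrite ltr_wpDr.
pose K := (-1) ^+ n * (rising u n * rising v n / rising (g + r%:R) n)
  / rising g r.
transitivity (K * \sum_(j < n.+1) (-1) ^+ j * 'C(n, j)%:R * S.[j%:R]);
  last by rewrite alternating_binomial_sum // mulr0.
rewrite mulr_sumr; apply: eq_bigr => j _; rewrite /S !hornerM !horner_rising.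
have D (z : R) : rising z (k + j) = rising z j * rising (j%:R + z) k.
  by rewrite addnC risingD [z + _]addrC.
have E : rising g r * rising (g + r%:R) j
    = rising g (k + j) * rising (j%:R + (g + k%:R)) (r - k).
  rewrite -risingD [j%:R + _]addrC -addrA -natrD -risingD; congr rising.
  by lia.
have nz1 : rising g r != 0 by rewrite rising_neq0.
have nz2 : rising g (k + j) != 0 by rewrite rising_neq0.
have nz3 : rising u j != 0 by rewrite rising_neq0.
have nz4 : rising v j != 0 by rewrite rising_neq0.
have nz5 : rising (g + r%:R) n != 0 by rewrite rising_neq0.
have E' : rising (g + r%:R) j / rising g (k + j)
    = rising (j%:R + (g + k%:R)) (r - k) / rising g r.
  apply/eqP; rewrite eqr_div // mulrC E mulrC; exact/eqP.
rewrite /hyp_coef /K exprD (D u) (D v).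
transitivity ((-1) ^+ n * (-1) ^+ j * 'C(n, j)%:R
  * (rising u n * rising v n / rising (g + r%:R) n)
  * rising (j%:R + u) k * rising (j%:R + v) k
  * (rising (g + r%:R) j / rising g (k + j))).
  by field; rewrite nz2 nz3 nz4 nz5.
by rewrite E'; field; rewrite nz1 nz5.
Qed.

(** The hypothesis is the equation theta (theta + a) (theta + b) p =
x (theta - s) (theta + e) p on coefficients, where theta = x d/dx; the
conclusion is this equation divided by x and expanded in derivatives. *)
Lemma hypergeometric_ode {R : comNzRingType} (a b e s : R) (p : {poly R}) :
  (forall j, j.+1%:R * (a + 1 + j%:R) * (b + 1 + j%:R) * p`_j.+1
             = (j%:R - s) * (e + j%:R) * p`_j) ->
  'X^2 * p^`()^`()^`() - 'X * ('X - (a + b + 3)%:P) * p^`()^`()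
  + ((s - 1 - e)%:P * 'X + ((a + 1) * (b + 1))%:P) * p^`()
  + (s * e)%:P * p = 0.
Proof.
move=> rec; apply/polyP => j; rewrite coef0.
have -> : 'X^2 * p^`()^`()^`() - 'X * ('X - (a + b + 3)%:P) * p^`()^`()
  + ((s - 1 - e)%:P * 'X + ((a + 1) * (b + 1))%:P) * p^`()
  + (s * e)%:P * p
  = 'X^2 * p^`()^`()^`() - 'X^2 * p^`()^`()
    + (a + b + 3)%:P * ('X * p^`()^`())
    + (s - 1 - e)%:P * ('X * p^`()) + ((a + 1) * (b + 1))%:P * p^`()
  + (s * e)%:P * p by ring.
rewrite !(coefD, coefN, coefCM, coefXnM, coefXM, coef_deriv).
have := rec j; case: j => [|[|j]] /= recj.
- rewrite !mulr1n in recj *; transitivity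
    (1%:R * (a + 1 + 0%:R) * (b + 1 + 0%:R) * p`_1
     - (0%:R - s) * (e + 0%:R) * p`_0); last by rewrite recj subrr.
  by ring.
- transitivity
    (2%:R * (a + 1 + 1%:R) * (b + 1 + 1%:R) * p`_2
     - (1%:R - s) * (e + 1%:R) * p`_1); last by rewrite recj subrr.
  by ring.
- rewrite !subSS subn0; transitivity
    (j.+3%:R * (a + 1 + j.+2%:R) * (b + 1 + j.+2%:R) * p`_j.+3
     - (j.+2%:R - s) * (e + j.+2%:R) * p`_j.+2); last by rewrite recj subrr.
  rewrite -(addn3 j) -(addn2 j) -(addn1 j) !natrD; ring.
Qed.

(** * Uniqueness of monic orthogonal polynomials *)

Lemma polynomial_sequence_spans {R : fieldType} (P : nat -> {poly R}) n
    (D : {poly R}) :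
  (forall m, size (P m) = m.+1) -> (size D <= n)%N ->
  exists c : nat -> R, D = \sum_(m < n) c m *: P m.
Proof.
move=> szP; elim: n D => [|n IHn] D szD.
  exists (fun=> 0); rewrite big_ord0; apply/eqP.
  by rewrite -size_poly_eq0 -leqn0.
pose t := D`_n / lead_coef (P n).
have lP : lead_coef (P n) != 0 by rewrite lead_coef_eq0 -size_poly_gt0 szP.
have szE : (size (D - t *: P n)%R <= n)%N.
  apply/leq_sizeP => j; rewrite leq_eqVlt coefB coefZ => /predU1P[<-|lt_nj].
    have -> : (P n)`_n = lead_coef (P n) by rewrite lead_coefE szP.
    by rewrite divfK // subrr.
  rewrite (nth_default _ (leq_trans szD lt_nj)) nth_default ?szP //.
  by rewrite mulr0 subrr.
have [c Ec] := IHn _ szE.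
exists (fun m => if m == n then t else c m).
rewrite big_ord_recr /= eqxx -[LHS](subrK (t *: P n)) Ec; congr (_ + _).
by apply: eq_bigr => m _; rewrite ltn_eqF.
Qed.

(** In the basis [P] the conditions on [D] form a triangular system whose diagonal
entries [l j (P j)] do not vanish. *)
Lemma orthogonal_eq0 {R : fieldType} (l : nat -> {scalar {poly R}})
    (P : nat -> {poly R}) n (D : {poly R}) :
  (forall m, size (P m) = m.+1) ->
  (forall j m, (j < m)%N -> l j (P m) = 0) ->
  (forall j, l j (P j) <> 0) ->
  (size D <= n)%N -> (forall j, (j < n)%N -> l j D = 0) -> D = 0.
Proof.
move=> szP lP0 lP szD lD.
have [c Ec] := polynomial_sequence_spans szP szD.
suff c0 j : (j < n)%N -> c j = 0.
  by rewrite Ec big1 // => m _; rewrite c0 // scale0r.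
elim/ltn_ind: j => j IHj lt_jn.
have := lD j lt_jn; rewrite Ec linear_sum (bigD1 (Ordinal lt_jn)) //= big1.
  by rewrite addr0 linearZ /= => /eqP; rewrite mulf_eq0 => /orP[/eqP|/eqP/lP].
move=> m neq_mj; rewrite linearZ /=.
have [lt_mj|lt_jm|eq_mj] := ltngtP m j.
- by rewrite IHj // mul0r.
- by rewrite lP0 // mulr0.
- by case/eqP: neq_mj; exact: val_inj.
Qed.

Definition moment_functional {R : comNzRingType} (m : nat -> R) (k : nat)
    (p : {poly R}) : R := \sum_(i < size p) p`_i * m (k + i)%N.

Lemma moment_functionalE {R : comNzRingType} (m : nat -> R) k n (p : {poly R}) :
  (size p <= n)%N ->
  moment_functional m k p = \sum_(i < n) p`_i * m (k + i)%N.
Proof.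
move=> szp; rewrite /moment_functional (big_ord_widen n (fun i => p`_i * m (k + i)%N)) //.
rewrite big_mkcond; apply: eq_bigr => i _; case: ltnP => // szi.
by rewrite nth_default // mul0r.
Qed.

Lemma moment_functional_is_linear {R : comNzRingType} (m : nat -> R) k :
  scalar (moment_functional m k).
Proof.
move=> c p q; pose n := maxn (size p) (size q).
have szp : (size p <= n)%N by rewrite leq_maxl.
have szq : (size q <= n)%N by rewrite leq_maxr.
have szcp : (size (c *: p) <= n)%N by rewrite (leq_trans (size_scale_leq _ _)).
have szr : (size (c *: p + q)%R <= n)%N.
  by rewrite (leq_trans (size_polyD _ _)) // geq_max szcp.
rewrite !(@moment_functionalE _ m k n) // mulr_sumr -big_split /=.
by apply: eq_bigr => i _; rewrite coefD coefZ mulrDl mulrA.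
Qed.

HB.instance Definition _ (R : comNzRingType) (m : nat -> R) (k : nat) :=
  GRing.isLinear.Build R {poly R} R *%R (moment_functional m k)
    (moment_functional_is_linear m k).

Definition power_moment {R : realType} (w : R -> R) (k : nat) : R :=
  integral0y (fun x => x ^+ k * w x).

(** The integrability of all power moments is what makes the total integral
additive, so that a polynomial can be integrated term by term. *)
Lemma momentE {R : realType} (w : R -> R) k (p : {poly R}) :
  (forall j, (@lebesgue_measure R).-integrable `]0%R, +oo[%classic
    (EFin \o (fun x => x ^+ j * w x))) ->
  moment w k p = moment_functional (power_moment w) k p.
Proof.
move=> iw.
pose h i := fun x : R => p`_i * (x ^+ (k + i) * w x).
have ih i : (@lebesgue_measure R).-integrable `]0%R, +oo[%classic (EFin \o h i).
  rewrite (_ : EFin \o _ = fun x => ((p`_i)%:E * (x ^+ (k + i) * w x)%:E)%E) //.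
  by apply: integrableZl; [exact: measurable_itv|exact: iw].
transitivity (integral0y (fun x => \sum_(i < size p) h i x)).
  apply: eq_Rintegral => x _; rewrite horner_coef mulr_sumr mulr_suml.
  by apply: eq_bigr => i _; rewrite /h exprD; ring.
rewrite /integral0y /Rintegral; under eq_integral do rewrite -sumEFin.
rewrite integral_sum; [|exact: measurable_itv|by move=> i; exact: ih].
rewrite -[RHS]/(fine (moment_functional (power_moment w) k p)%:E); congr fine.
rewrite /moment_functional -sumEFin; apply: eq_bigr => i _.
rewrite -[LHS]fineK; last first.
  by apply: integrable_fin_num; [exact: measurable_itv|exact: ih].
by congr EFin; rewrite -/(Rintegral _ _ _) RintegralZl //; exact: iw.
Qed.

(** The difference of the two polynomials has degree less than n and satisfies the
n conditions of [orthogonal_eq0]. *)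
Lemma monic_orthogonal_unique {R : fieldType} (l : nat -> {scalar {poly R}})
    (P : nat -> {poly R}) n (Q : {poly R}) :
  (forall m, size (P m) = m.+1) -> P n \is monic -> Q \is monic ->
  size Q = n.+1 ->
  (forall j m, (j < m)%N -> l j (P m) = 0) ->
  (forall j, l j (P j) <> 0) ->
  (forall j, (j < n)%N -> l j Q = 0) -> P n = Q.
Proof.
move=> szP mP mQ szQ lP0 lP lQ; apply/eqP; rewrite -subr_eq0; apply/eqP.
apply: (orthogonal_eq0 szP lP0 lP (n := n)) => [|j lt_jn].
  apply/leq_sizeP => j; rewrite leq_eqVlt coefB => /predU1P[<-|lt_nj].
    have -> : (P n)`_n = 1 by rewrite -[1](monicP mP) lead_coefE szP.
    have -> : Q`_n = 1 by rewrite -[1](monicP mQ) lead_coefE szQ.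
    exact: subrr.
  by rewrite !nth_default ?szP ?szQ // subr0.
by rewrite raddfB /= lP0 // lQ // subr0.
Qed.

Lemma size_hyp_poly {R : realFieldType} (e u v : R) n :
  0 < e -> 0 < u -> 0 < v -> size (hyp_poly e u v n) = n.+1.
Proof.
move=> e0 u0 v0; apply/eqP; rewrite eqn_leq size_poly /=.
by rewrite ltnNge; apply/negP => /leq_sizeP/(_ n (leqnn n))/eqP;
  rewrite coef_hyp_poly hyp_coef_lead // oner_eq0.
Qed.

Lemma monic_hyp_poly {R : realFieldType} (e u v : R) n :
  0 < e -> 0 < u -> 0 < v -> hyp_poly e u v n \is monic.
Proof.
move=> e0 u0 v0; rewrite monicE lead_coefE size_hyp_poly //.
by rewrite coef_hyp_poly hyp_coef_lead.
Qed.

(** The shape of the moments is that of [moment_calW]; the factor [K] keeps the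
value of the total mass out of the argument. *)
Lemma moment_functional_hyp_poly_eq0 {R : realFieldType} (g u v K : R) m n k r :
  0 < g -> 0 < u -> 0 < v -> (k <= r)%N -> (k + r < n)%N ->
  (forall j, m j = K * (rising u j * rising v j / rising g j)) ->
  moment_functional m k (hyp_poly (g + r%:R) u v n) = 0.
Proof.
move=> g0 u0 v0 le_kr lt_krn mE.
rewrite (@moment_functionalE _ _ _ n.+1) ?size_poly //.
transitivity (K * \sum_(j < n.+1) hyp_coef (g + r%:R) u v n j
    * (rising u (k + j) * rising v (k + j) / rising g (k + j)));
  last by rewrite hyp_poly_orthogonal // mulr0.
by rewrite mulr_sumr; apply: eq_bigr => j _; rewrite coef_hyp_poly mE mulrCA.
Qed.

(** * Integrals over the open half-line *)

Section HalfLine.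
Local Open Scope classical_set_scope.
Local Open Scope ring_scope.
Context {R : realType}.
Local Notation mu := (@lebesgue_measure R).
Implicit Types (f g h F : R -> R) (p x l : R).

(** The value is an extended real, so that identities between integrals of
nonnegative functions can be stated and used before these are known to be
finite. *)
Definition eint0y f : \bar R := (\int[mu]_(x in `]0%R, +oo[) (f x)%:E)%E.

Definition continuous0y f := {in `]0, +oo[, continuous f}.

(** The factor [p] makes the substitution x -> p x carry one exhaustion of the
half-line to another; starting at 2 keeps the intervals nondegenerate. *)
Definition compact_itv (p : R) (n : nat) : set R := `[p / n.+2%:R, p * n.+2%:R]%classic.

Lemma bigcup_compact_itv p : 0 < p -> (\bigcup_n compact_itv p n = `]0, +oo[)%classic.
Proof.
move=> p0; apply/seteqP; split => x /=.
  move=> [n _]; rewrite /compact_itv /= !in_itv /= andbT => /andP[+ _].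
  by apply: lt_le_trans; rewrite divr_gt0.
rewrite in_itv /= andbT => x0.
pose n := Num.truncn (x / p + p / x).
have lt_n : x / p + p / x < n.+1%:R by rewrite truncnS_gt // addr_ge0 // divr_ge0 // ltW.
have lt_n2 : x / p + p / x < n.+2%:R by rewrite (lt_trans lt_n) // ltr_nat.
exists n => //; rewrite /compact_itv /= in_itv /=; apply/andP; split.
  rewrite ler_pdivrMr // mulrC -ler_pdivrMr //; apply/ltW/(le_lt_trans _ lt_n2).
  by rewrite lerDr divr_ge0 // ltW.
rewrite mulrC -ler_pdivrMr //; apply/ltW/(le_lt_trans _ lt_n2).
by rewrite lerDl divr_ge0 // ltW.
Qed.

Lemma sub_compact_itv p n : 0 < p -> (compact_itv p n `<=` `]0, +oo[)%classic.
Proof. by move=> p0; rewrite -(bigcup_compact_itv p0); exact: bigcup_sup. Qed.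

Lemma continuous0y_measurable f : continuous0y f -> measurable_fun `](0 : R), +oo[ f.
Proof.
move=> cf; apply: open_continuous_measurable_fun => //.
by move=> x /set_mem xD; exact: cf.
Qed.

Lemma continuous0y_within f p n : 0 < p -> continuous0y f ->
  {within compact_itv p n, continuous f}.
Proof.
move=> p0 cf; apply: continuous_in_subspaceT => x /set_mem xn.
by apply: cf; exact: sub_compact_itv xn.
Qed.

Lemma cvg_eint0y f p : 0 < p -> (forall x, 0 < x -> 0 <= f x) ->
  measurable_fun `](0 : R), +oo[ f ->
  ((\int[mu]_(x in compact_itv p n) (f x)%:E)%E @[n --> \oo] --> eint0y f)%classic.
Proof.
move=> p0 f0 mf; rewrite /eint0y -(bigcup_compact_itv p0).
apply: ge0_nondecreasing_set_cvg_integral.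
- apply/nondecreasing_seqP => n; apply/subsetPset; apply: subset_itv.
  + by rewrite bnd_simp ler_pM2l // lef_pV2 ?posrE // ler_nat.
  + by rewrite bnd_simp ler_pM2l // ler_nat.
- by move=> n; exact: measurable_itv.
- move=> n; apply/measurable_EFinP; apply: measurable_funS mf => //.
  exact: sub_compact_itv.
- move=> n x /(sub_compact_itv p0) /=; rewrite in_itv /= andbT lee_fin.
  exact: f0.
Qed.

Lemma eint0y_ge0 f : (forall x, 0 < x -> 0 <= f x) -> (0 <= eint0y f)%E.
Proof.
move=> f0; apply: integral_ge0 => x /=; rewrite in_itv /= andbT lee_fin.
exact: f0.
Qed.

(** The integrals are compared on compact intervals, where the fundamental theorem
applies, and monotone convergence gives the limit. Splitting the derivative of
[F] into two nonnegative parts covers integration by parts without assuming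
that either integral is finite; singularities at 0 are allowed. *)
Lemma eint0y_FTC F g h (l0 l1 : R) :
  (forall x, 0 < x -> is_derive x 1 F (g x - h x)) ->
  (forall x, 0 < x -> 0 <= g x) -> (forall x, 0 < x -> 0 <= h x) ->
  continuous0y g -> continuous0y h ->
  F x @[x --> 0^'+] --> l0 -> F x @[x --> +oo] --> l1 ->
  (eint0y g = eint0y h + (l1 - l0)%:E)%E.
Proof.
move=> dF g0 h0 cg ch F0 Fy.
have p0 : 0 < 1 :> R by [].
have Ig := cvg_eint0y p0 g0 (continuous0y_measurable cg).
have Ih := cvg_eint0y p0 h0 (continuous0y_measurable ch).
have cFn : ((F (1 * n.+2%:R) - F (1 / n.+2%:R))%:E @[n --> \oo] --> (l1 - l0)%:E)%classic.
  apply: cvg_EFin; first exact: nearW.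
  apply: cvgB.
    apply: cvg_comp Fy.
    under eq_cvg do rewrite mul1r.
    apply/cvgryPge => A; near=> n.
    apply: (@le_trans _ _ n%:R); last by rewrite ler_nat leqW.
    near: n; exact: nbhs_infty_ger.
  apply: ((cvg_at_rightP F 0 l0).1 F0); split=> [n|]; first by rewrite divr_gt0.
  have := @cvg_harmonic R; rewrite -cvg_shiftS; apply: cvg_trans.
  by apply: near_eq_cvg; apply: nearW => n /=; rewrite div1r.
apply/esym/(cvg_unique _ _ Ig); first by [].
apply: cvg_trans (cvgeD _ Ih cFn); last exact: fin_num_adde_defl.
apply: near_eq_cvg; apply: nearW => n /=.
have cn f : continuous0y f -> mu.-integrable (compact_itv 1 n) (EFin \o f).
  move=> cf; apply: continuous_compact_integrable; first exact: segment_compact.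
  exact: continuous0y_within.
have lt_uv : 1 / n.+2%:R < 1 * n.+2%:R :> R.
  by rewrite div1r mul1r (@lt_trans _ _ 1) // ?invf_lt1 ?ltr1n.
have u0 : 0 < 1 / n.+2%:R :> R by rewrite divr_gt0.
have cF x : 0 < x -> {for x, continuous F}.
  move=> x0; apply/differentiable_continuous/derivable1_diffP.
  by case: (dF x x0).
rewrite EFinB -(@continuous_FTC2 _ (fun x => g x - h x) F) //.
- under [X in (_ + X)%E]eq_integral do rewrite EFinB.
  rewrite integralB_EFin //; [|exact: cn..].
  rewrite -/(compact_itv 1 n) [LHS]addeC; apply: subeK.
  by apply: integrable_fin_num; [exact: measurable_itv | exact: (cn h ch)].
- apply: continuous_in_subspaceT => x /set_mem xn.
  have xD := sub_compact_itv p0 xn.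
  by apply: cvgB; [exact: cg | exact: ch].
- split.
  + move=> x; rewrite in_itv /= => /andP[ux _].
    by case: (dF x (lt_trans u0 ux)).
  + by apply: cvg_at_right_filter; apply: cF.
  + by apply: cvg_at_left_filter; apply: cF; apply: lt_trans lt_uv.
- move=> x; rewrite in_itv /= => /andP[ux _].
  by rewrite derive1E; case: (dF x (lt_trans u0 ux)).
Unshelve. all: by end_near. Qed.

Lemma eq_eint0y f g : (forall x, 0 < x -> f x = g x) -> eint0y f = eint0y g.
Proof.
move=> fg; apply: eq_integral => x /set_mem /=; rewrite in_itv /= andbT => x0.
by rewrite fg.
Qed.

Lemma eint0yZ f p : 0 <= p -> (forall x, 0 < x -> 0 <= f x) ->
  measurable_fun `](0 : R), +oo[ f ->
  (eint0y (fun x => p * f x)%R = p%:E * eint0y f)%E.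
Proof.
move=> p0 f0 mf; rewrite /eint0y -ge0_integralZl_EFin //.
- by move=> x /=; rewrite in_itv /= andbT lee_fin => /f0.
- exact/measurable_EFinP.
Qed.

Lemma eint0yD f g :
  (forall x, 0 < x -> 0 <= f x) -> (forall x, 0 < x -> 0 <= g x) ->
  measurable_fun `](0 : R), +oo[ f -> measurable_fun `](0 : R), +oo[ g ->
  (eint0y (fun x => f x + g x)%R = eint0y f + eint0y g)%E.
Proof.
move=> f0 g0 mf mg; rewrite /eint0y -ge0_integralD //.
- by move=> x /=; rewrite in_itv /= andbT lee_fin => /f0.
- exact/measurable_EFinP.
- by move=> x /=; rewrite in_itv /= andbT lee_fin => /g0.
- exact/measurable_EFinP.
Qed.

Lemma eint0y_le f g :
  (forall x, 0 < x -> 0 <= f x) -> (forall x, 0 < x -> f x <= g x) ->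
  measurable_fun `](0 : R), +oo[ f -> measurable_fun `](0 : R), +oo[ g ->
  (eint0y f <= eint0y g)%E.
Proof.
move=> f0 fg mf mg; apply: ge0_le_integral => //.
- by move=> x /=; rewrite in_itv /= andbT lee_fin => /f0.
- exact/measurable_EFinP.
- exact/measurable_EFinP.
- by move=> x /=; rewrite in_itv /= andbT lee_fin => /fg.
Qed.

(** The substitution x -> p x is made on the compact intervals, since [f] may be
singular at 0. *)
Lemma eint0y_scale f p : 0 < p -> (forall x, 0 < x -> 0 <= f x) ->
  continuous0y f -> eint0y f = eint0y (fun x => p * f (p * x)).
Proof.
move=> p0 f0 cf.
have cM : continuous ( *%R p) by exact: mulrl_continuous.
have cfM : continuous0y (fun x => p * f (p * x)).
  move=> x; rewrite in_itv /= andbT => x0.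
  apply: cvgM; first exact: cvg_cst.
  apply: (continuous_comp (cM x)); apply: cf.
  by rewrite in_itv /= andbT mulr_gt0.
have dM x : is_derive x 1 ( *%R p) p.
  by apply: is_derive_eq; exact: mulr1.
have dME : (( *%R p)^`())%classic = cst p.
  by apply/funext => x; rewrite derive1E; case: (dM x).
have I1 := cvg_eint0y p0 f0 (continuous0y_measurable cf).
have f0M x : 0 < x -> 0 <= p * f (p * x).
  by move=> x0; rewrite mulr_ge0 ?f0 ?mulr_gt0 // ltW.
have I2 := cvg_eint0y ltr01 f0M (continuous0y_measurable cfM).
apply: (cvg_unique _ I1); first by [].
apply: cvg_trans I2; apply: near_eq_cvg; apply: nearW => n /=.
have le_uv : 1 / n.+2%:R <= 1 * n.+2%:R :> R.
  by rewrite div1r mul1r (@le_trans _ _ 1) // ?invf_le1 ?ler1n.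
rewrite /compact_itv.
have -> : `[p / n.+2%:R, p * n.+2%:R] = `[p * (1 / n.+2%:R), p * (1 * n.+2%:R)].
  by rewrite div1r mul1r.
rewrite [RHS](@integration_by_substitution_increasing _ ( *%R p)) //.
- by apply: eq_integral => x _; rewrite /= fctE dME /= mulrC.
- by move=> x y _ _; rewrite ltr_pM2l.
- by rewrite dME => x _; exact: cvg_cst.
- by rewrite dME; exact: is_cvg_cst.
- by rewrite dME; exact: is_cvg_cst.
- split; first by move=> x _; case: (dM x).
  + by apply: cvg_at_right_filter; exact: cM.
  + by apply: cvg_at_left_filter; exact: cM.
- by rewrite div1r mul1r; exact: continuous0y_within.
Qed.

End HalfLine.

(** * Powers and Beta integrals *)

Section Integrals.
Context {R : realType}.
Local Open Scope classical_set_scope.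
Local Open Scope ring_scope.
Implicit Types (c s z x t m : R).

Lemma continuous0yM (f g : R -> R) :
  continuous0y f -> continuous0y g -> continuous0y (fun x => f x * g x).
Proof. by move=> cf cg x x0; apply: cvgM; [exact: cf|exact: cg]. Qed.

Lemma continuous0yD (f g : R -> R) :
  continuous0y f -> continuous0y g -> continuous0y (fun x => f x + g x).
Proof. by move=> cf cg x x0; apply: cvgD; [exact: cf|exact: cg]. Qed.

Lemma continuous0y_cst (k : R) : continuous0y (fun=> k).
Proof. by move=> x x0; exact: cvg_cst. Qed.

Lemma continuous0y_derivable (f : R -> R) :
  (forall x, 0 < x -> derivable f x 1) -> continuous0y f.
Proof.
move=> df x; rewrite in_itv /= andbT => x0.
by apply/differentiable_continuous/derivable1_diffP; exact: df.
Qed.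

Lemma continuous0y_powR s : continuous0y (fun x => x `^ s).
Proof.
by apply: continuous0y_derivable => x x0; case: (is_derive1_powR s x0).
Qed.

Lemma is_derive_powR_add1 s x : 0 < x ->
  is_derive x 1 (fun t => (t + 1) `^ s) (s * (x + 1) `^ (s - 1)).
Proof.
move=> x0; have x1 : 0 < x + 1 by rewrite addr_gt0.
have d := is_derive1_powR s x1.
have dx : is_derive x 1 (fun t : R => t + 1) 1.
  by apply: is_derive_eq; rewrite addr0.
have := @is_derive1_comp _ (fun y => y `^ s) (fun t => t + 1) _ _ _ d dx.
by rewrite mulr1.
Qed.

Lemma continuous0y_powR_add1 s : continuous0y (fun x => (x + 1) `^ s).
Proof.
by apply: continuous0y_derivable => x /(is_derive_powR_add1 s) [].
Qed.

Lemma is_derive_expRN m x :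
  is_derive x 1 (fun t => expR (- (t * m))) (- m * expR (- (x * m))).
Proof.
have dx : is_derive x 1 (fun t : R => - (t * m)) (- m).
  by apply: is_derive_eq; rewrite scaler0 add0r; congr (- _); exact: mulr1.
have := @is_derive1_comp _ _ _ _ _ _ (is_derive_expR _) dx.
by rewrite mulrC.
Qed.

Lemma continuous0y_expRN m : continuous0y (fun x => expR (- (x * m))).
Proof.
by apply: continuous0y_derivable => x _; case: (is_derive_expRN m x).
Qed.

Lemma cvgy_powR_add1 s : 0 < s -> (x + 1) `^ (- s) @[x --> +oo] --> 0.
Proof.
move=> s0; have invy : (x + 1)^-1 @[x --> +oo] --> (0 : R)^'+.
  have inv0 : (x + 1)^-1 @[x --> +oo] --> (0 : R).
    apply/(@gtr0_cvgV0 _ _ _ _ (fun x : R => x + 1)).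
      near=> x; rewrite addr_gt0 //; near: x; exact: nbhs_pinfty_gt.
    apply/cvgryPge => A; near=> x; rewrite -lerBlDr; near: x.
    apply: nbhs_pinfty_ge; exact: num_real.
  move=> A /inv0 /=; apply: filterS2 (nbhs_pinfty_gt (real0 R)) => x x0.
  by apply; rewrite /= invr_gt0 addr_gt0.
have := cvg_comp _ _ invy (powR_cvg0 s0); apply: cvg_trans.
apply: near_eq_cvg; near=> x => /=.
have x0 : 0 < x by near: x; exact: nbhs_pinfty_gt.
by rewrite -powR_inv1 -?powRrM ?mulN1r // addr_ge0 // ltW.
Unshelve. all: by end_near. Qed.

(** For m > 0, a multiple of 1 + t x / m bounds t + 1, and 1 + y <= e^y; the bound
follows by taking the m-th power. *)
Lemma powR_add1_le_expR m x : 0 < x ->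
  exists2 C : R, 0 <= C & forall t, 0 < t -> (t + 1) `^ m * expR (- (t * x)) <= C.
Proof.
move=> x0; have [m0|m0] := leP m 0.
  exists 1 => // t t0; rewrite mulr_ile1 ?powR_ge0 ?expR_ge0 //.
  - have t1 : 1 <= t + 1 by rewrite lerDr ltW.
    by have := ler_powR t1 m0; rewrite powRr0.
  - by rewrite -expR0 ler_expR oppr_le0 mulr_ge0 ?ltW.
have xm : 0 < x / m by rewrite divr_gt0.
pose K := Num.max 1 (x / m)^-1.
exists (K `^ m) => [|t t0]; first exact: powR_ge0.
have K0 : 0 <= K by rewrite le_max ler01.
have tK : t + 1 <= K * expR (t * (x / m)).
  apply: (@le_trans _ _ (K * (1 + t * (x / m)))); last first.
    by rewrite ler_wpM2l // expR_ge1Dx.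
  rewrite mulrDr mulr1 addrC lerD ?le_max ?lexx //.
  rewrite mulrCA ler_pMr // -ler_pdivrMr //.
  by rewrite div1r le_max lexx orbT.
have -> : expR (- (t * x)) = expR (t * (x / m)) `^ (- m).
  by rewrite -expRM; congr expR; field; rewrite gt_eqF.
rewrite powRN ler_pdivrMr ?powR_gt0 ?expR_gt0 // -powRM ?expR_ge0 //.
apply: ge0_ler_powR => //; first exact: ltW.
- by rewrite nnegrE addr_ge0 // ltW.
- by rewrite nnegrE mulr_ge0 ?expR_ge0.
Qed.

(** The integral of this function over the half-line is Beta(c, s - c). *)
Definition beta_kernel c s t := t `^ (c - 1) * (t + 1) `^ (- s).

Lemma beta_kernel_ge0 c s t : 0 <= beta_kernel c s t.
Proof. by rewrite mulr_ge0 ?powR_ge0. Qed.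

Lemma continuous0y_beta_kernel c s : continuous0y (beta_kernel c s).
Proof.
by apply: continuous0yM; [exact: continuous0y_powR|exact: continuous0y_powR_add1].
Qed.

Lemma mulr_powR_sub1 s t : 0 < t -> t * t `^ (s - 1) = t `^ s.
Proof.
move=> t0; rewrite -{1}(powRr1 (ltW t0)) -powRD ?(gt_eqF t0) ?implybT //.
by congr powR; ring.
Qed.

(** The derivative is rearranged, using t = (t + 1) - 1, so that it only involves
Beta kernels with the same first parameter. *)
Lemma is_derive_beta_primitive c s t : 0 < t ->
  is_derive t 1 (fun t => t `^ c * (t + 1) `^ (- s))
    (c * beta_kernel c s t + s * beta_kernel c (s + 1) t - s * beta_kernel c s t).
Proof.
move=> t0; have d1 := is_derive1_powR c t0.
have d2 := is_derive_powR_add1 (- s) t0.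
have d := @is_deriveM _ _ _ _ _ _ _ _ d1 d2.
apply: (is_derive_eq d); rewrite /GRing.scale /= /beta_kernel.
have t1 : 0 < t + 1 by rewrite addr_gt0.
rewrite -(mulr_powR_sub1 c t0) -(mulr_powR_sub1 (- s) t1) opprD.
set A := t `^ _; set B := (t + 1) `^ _; ring.
Qed.

Lemma continuous_powR s x : 0 < x -> {for x, continuous (fun y : R => y `^ s)}.
Proof.
move=> /(is_derive1_powR s) [d _].
by apply/differentiable_continuous/derivable1_diffP.
Qed.

Lemma cvg0_powR_add1 s : (t + 1) `^ s @[t --> 0^'+] --> (1 : R).
Proof.
have cvg1 : t + 1 @[t --> (0 : R)^'+] --> (1 : R).
  rewrite -[X in _ --> X](add0r 1); apply: cvg_at_right_filter.
  by apply: cvgD; [exact: cvg_id|exact: cvg_cst].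
by have := cvg_comp _ _ cvg1 (@continuous_powR s _ ltr01); rewrite powR1.
Qed.

Lemma cvg0_beta_primitive c s : 0 < c ->
  t `^ c * (t + 1) `^ (- s) @[t --> 0^'+] --> (0 : R).
Proof.
move=> c0; rewrite -[X in _ --> X](mul0r 1).
by apply: cvgM; [exact: powR_cvg0|exact: cvg0_powR_add1].
Qed.

Lemma cvgy_beta_primitive c s : 0 < c -> c < s ->
  t `^ c * (t + 1) `^ (- s) @[t --> +oo] --> (0 : R).
Proof.
move=> c0 lt_cs; have := @cvgy_powR_add1 (s - c); rewrite subr_gt0.
move=> /(_ lt_cs); apply: squeeze_cvgr (cvg_cst 0).
near=> t; have t0 : 0 < t by near: t; exact: nbhs_pinfty_gt.
rewrite mulr_ge0 ?powR_ge0 //= opprB powRD ?(gt_eqF (addr_gt0 t0 ltr01)) ?implybT //.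
rewrite ler_wpM2r ?powR_ge0 // ge0_ler_powR ?nnegrE ?addr_ge0 ?lerDl // ltW //.
Unshelve. all: by end_near. Qed.

(** The kernel is the derivative of (t / (t + 1))^c / c. *)
Lemma eint0y_beta_succ c : 0 < c ->
  (c%:E * eint0y (beta_kernel c (c + 1)) = 1)%E.
Proof.
move=> c0; rewrite -eint0yZ; last 3 first.
- exact: ltW.
- by move=> x _; exact: beta_kernel_ge0.
- by apply: continuous0y_measurable; exact: continuous0y_beta_kernel.
have -> : (eint0y (fun x => c * beta_kernel c (c + 1) x)%R
    = eint0y (fun=> 0%R) + (1 - 0)%R%:E)%E.
  apply: (@eint0y_FTC _ (fun t => t `^ c * (t + 1) `^ (- c))).
  - move=> x x0; apply: (is_derive_eq (is_derive_beta_primitive c c x0)).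
    by rewrite subr0 addrAC subrr add0r.
  - by move=> x _; rewrite mulr_ge0 ?beta_kernel_ge0 ?ltW.
  - by [].
  - apply: continuous0yM; [exact: continuous0y_cst|exact: continuous0y_beta_kernel].
  - exact: continuous0y_cst.
  - exact: cvg0_beta_primitive.
  have cvg1 : 1 - (t + 1) `^ (- 1) @[t --> +oo] --> (1 : R).
    rewrite -[X in _ --> X]subr0; apply: cvgB; first exact: cvg_cst.
    exact: cvgy_powR_add1.
  have := cvg_comp _ _ cvg1 (@continuous_powR c _ ltr01); rewrite powR1; apply: cvg_trans.
  apply: near_eq_cvg; near=> t => /=.
  have t0 : 0 < t by near: t; exact: nbhs_pinfty_gt.
  have t1 : 0 < t + 1 by rewrite addr_gt0.
  have -> : 1 - (t + 1) `^ (- 1) = t * (t + 1) `^ (- 1).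
    by rewrite powR_inv1 ?ltW //; field; rewrite gt_eqF.
  by rewrite powRM ?powR_ge0 ?ltW // -powRrM mulN1r.
by rewrite /eint0y integral0 add0e subr0.
Unshelve. all: by end_near. Qed.

Lemma eint0y_powR_add1 c : 0 < c ->
  (eint0y (fun t => c * (t + 1) `^ (- c - 1))%R = 1)%E.
Proof.
move=> c0; transitivity (eint0y (fun=> (0 : R)%R) + (0 - - 1)%R%:E)%E; last first.
  by rewrite /eint0y integral0 add0e sub0r opprK.
apply: (@eint0y_FTC _ (fun t => - (t + 1) `^ (- c))).
- move=> x x0.
  have d := is_derive_powR_add1 (- c) x0; apply: (is_derive_eq (is_deriveN _)).
  by rewrite subr0 mulNr opprK.
- by move=> x _; rewrite mulr_ge0 ?powR_ge0 ?ltW.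
- by [].
- apply: continuous0yM; [exact: continuous0y_cst|exact: continuous0y_powR_add1].
- exact: continuous0y_cst.
- apply: cvgN; exact: cvg0_powR_add1.
- by rewrite -[X in _ --> X]oppr0; apply: cvgN; exact: cvgy_powR_add1.
Qed.

(** Both terms on the right have elementary primitives: the first one controls the
singularity at 0, the second one the tail. *)
Lemma beta_kernel_le c s t : 0 < c -> c < s -> 0 < t ->
  beta_kernel c s t <= 2 * beta_kernel c (c + 1) t + 2 * (t + 1) `^ (- (s - c) - 1).
Proof.
move=> c0 lt_cs t0; have t1 : 0 < t + 1 by rewrite addr_gt0.
have t1n : t + 1 != 0 by rewrite gt_eqF.
rewrite /beta_kernel; have [le_t1|lt_1t] := leP t 1.
(* For t <= 1 the factor (t + 1)^(1 - (s - c)) is at most 2. *)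
- apply: ler_wpDr; first by rewrite mulr_ge0 ?powR_ge0.
  rewrite mulrCA ler_wpM2l ?powR_ge0 //.
  have -> : - s = (1 - (s - c)) - (c + 1) by ring.
  rewrite powRD ?t1n ?implybT // ler_wpM2r ?powR_ge0 //.
  apply: (@le_trans _ _ ((t + 1) `^ 1)).
    by apply: ler_powR; [rewrite lerDr ltW | rewrite gerBl subr_ge0 ltW].
  by rewrite powRr1 ?(ltW t1) //; lra.
(* For t > 1 the factor t^(c - 1) (t + 1)^(1 - c) is at most 2. *)
- apply: ler_wpDl; first by rewrite mulr_ge0 // mulr_ge0 ?powR_ge0.
  have -> : - s = (1 - c) + (- (s - c) - 1) by ring.
  rewrite (@powRD _ _ (1 - c)) ?t1n ?implybT // mulrA ler_wpM2r ?powR_ge0 //.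
  have [le_1c|lt_c1] := leP 1 c.
    apply: (@le_trans _ _ 1); last by lra.
    rewrite -[1 - c]opprB powRN ler_pdivrMr ?powR_gt0 // mul1r.
    by rewrite ge0_ler_powR ?nnegrE ?subr_ge0 ?lerDl // ltW.
  rewrite -[c - 1]opprB powRN mulrC ler_pdivrMr ?powR_gt0 //.
  apply: (@le_trans _ _ ((2 * t) `^ (1 - c))).
    by rewrite ge0_ler_powR ?nnegrE ?subr_ge0 ?mulr_ge0 ?(ltW t0) ?(ltW t1) ?(ltW lt_c1) //; lra.
  rewrite powRM ?(ltW t0) // ler_wpM2r ?powR_ge0 //.
  rewrite -[leRHS]powRr1 //; apply: ler_powR; first by rewrite ler1n.
  by rewrite gerBl ltW.
Qed.

Lemma eint0y_beta_fin c s : 0 < c -> c < s ->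
  (eint0y (beta_kernel c s) < +oo)%E.
Proof.
move=> c0 lt_cs; have d0 : 0 < s - c by rewrite subr_gt0.
pose f1 := fun t => 2 * beta_kernel c (c + 1) t.
pose f2 := fun t => 2 * (t + 1) `^ (- (s - c) - 1).
have cont1 : continuous0y (beta_kernel c (c + 1)) by exact: continuous0y_beta_kernel.
have cont2 : continuous0y (fun t => (t + 1) `^ (- (s - c) - 1)).
  exact: continuous0y_powR_add1.
have cf1 : continuous0y f1 by apply: continuous0yM => //; exact: continuous0y_cst.
have cf2 : continuous0y f2 by apply: continuous0yM => //; exact: continuous0y_cst.
have f10 x : 0 < x -> 0 <= f1 x by move=> _; rewrite mulr_ge0 ?beta_kernel_ge0.
have f20 x : 0 < x -> 0 <= f2 x by move=> _; rewrite mulr_ge0 ?powR_ge0.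
apply: (@le_lt_trans _ _ (eint0y (fun t => f1 t + f2 t)%R)).
  apply: eint0y_le => [x _|x x0||]; first exact: beta_kernel_ge0.
  - exact: beta_kernel_le.
  - by apply: continuous0y_measurable; exact: continuous0y_beta_kernel.
  - by apply: continuous0y_measurable; exact: continuous0yD.
have fin (g : R -> R) (k : R) :
    0 < k -> (k%:E * eint0y g = 1)%E -> (0 <= eint0y g)%E -> (eint0y g < +oo)%E.
  move=> k0; move: (eint0y g) => [r| |] //; first by rewrite ltry.
  by rewrite gt0_muley ?lte_fin // => /eqP; rewrite eqe_fin.
rewrite eint0yD //;
  [|exact: (continuous0y_measurable cf1)|exact: (continuous0y_measurable cf2)].
have E1 : (eint0y f1 = 2%:E * eint0y (beta_kernel c (c + 1)))%E.
  apply: eint0yZ => //; last exact: (continuous0y_measurable cont1).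
  by move=> x _; exact: beta_kernel_ge0.
have E2 : (eint0y f2 = 2%:E * eint0y (fun t => (t + 1) `^ (- (s - c) - 1))%R)%E.
  apply: eint0yZ => //; last exact: (continuous0y_measurable cont2).
  by move=> x _; exact: powR_ge0.
rewrite E1 E2; apply: lte_add_pinfty; apply: lte_mul_pinfty; rewrite ?lee_fin //.
- apply: (fin _ _ c0); first exact: eint0y_beta_succ.
  by apply: eint0y_ge0 => x _; exact: beta_kernel_ge0.
- apply: (fin _ _ d0); last by apply: eint0y_ge0 => x _; exact: powR_ge0.
  rewrite -[RHS](eint0y_powR_add1 d0) eint0yZ ?(ltW d0) //.
    by move=> x _; exact: powR_ge0.
  exact: (continuous0y_measurable cont2).
Qed.

(** Integration by parts; written without subtraction, it holds in the extended
reals. *)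
Lemma eint0y_beta_rec c s : 0 < c -> c < s ->
  (c%:E * eint0y (beta_kernel c s) + s%:E * eint0y (beta_kernel c (s + 1))
   = s%:E * eint0y (beta_kernel c s))%E.
Proof.
move=> c0 lt_cs; have s0 := lt_trans c0 lt_cs.
have mb u : measurable_fun `](0 : R), +oo[ (beta_kernel c u).
  by apply: continuous0y_measurable; exact: continuous0y_beta_kernel.
have b0 u (x : R) : 0 < x -> 0 <= beta_kernel c u x by move=> _; exact: beta_kernel_ge0.
have cb (k : R) u : continuous0y (fun t => k * beta_kernel c u t).
  apply: continuous0yM; [exact: continuous0y_cst|exact: continuous0y_beta_kernel].
have kb0 (k : R) u (x : R) : 0 <= k -> 0 < x -> 0 <= k * beta_kernel c u x.
  by move=> k0 x0; rewrite mulr_ge0 ?beta_kernel_ge0.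
rewrite -!eint0yZ ?(ltW c0) ?(ltW s0) //; [|exact: b0..].
rewrite -eint0yD; first last.
- by apply: continuous0y_measurable; exact: cb.
- by apply: continuous0y_measurable; exact: cb.
- by move=> x; apply: kb0; exact: ltW.
- by move=> x; apply: kb0; exact: ltW.
transitivity (eint0y (fun t => s * beta_kernel c s t)%R + (0 - 0)%R%:E)%E;
  last by rewrite subrr adde0.
apply: (@eint0y_FTC _ (fun t => t `^ c * (t + 1) `^ (- s))).
- by move=> x; exact: is_derive_beta_primitive.
- by move=> x x0; rewrite addr_ge0 // kb0 // ltW.
- by move=> x; apply: kb0; exact: ltW.
- exact: continuous0yD.
- exact: cb.
- exact: cvg0_beta_primitive.
- exact: cvgy_beta_primitive.
Qed.

End Integrals.

(** * Gamma integrals *)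

Section GammaIntegral.
Context {R : realType}.
Local Open Scope classical_set_scope.
Local Open Scope ring_scope.
Implicit Types (c s z x t p : R).

Definition gamma_kernel z x := x `^ (z - 1) * expR (- x).

Lemma gamma_kernel_ge0 z x : 0 <= gamma_kernel z x.
Proof. by rewrite mulr_ge0 ?powR_ge0 ?expR_ge0. Qed.

Lemma continuous0y_gamma_kernel z : continuous0y (gamma_kernel z).
Proof.
have -> : gamma_kernel z = fun x => x `^ (z - 1) * expR (- (x * 1)).
  by apply/funext => x; rewrite mulr1.
by apply: continuous0yM; [exact: continuous0y_powR|exact: continuous0y_expRN].
Qed.

Lemma measurable_gamma_kernel z : measurable_fun `](0 : R), +oo[ (gamma_kernel z).
Proof. by apply: continuous0y_measurable; exact: continuous0y_gamma_kernel. Qed.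

Lemma eint0y_gamma_fin z : 0 < z -> (eint0y (gamma_kernel z) < +oo)%E.
Proof.
move=> z0; have [C C0 leC] := @powR_add1_le_expR R (z + 1) 1 ltr01.
have cb := @continuous0y_beta_kernel R z (z + 1).
apply: (@le_lt_trans _ _ (eint0y (fun x => C * beta_kernel z (z + 1) x)%R)).
  apply: eint0y_le => [x _|x x0||]; first exact: gamma_kernel_ge0.
  - rewrite /gamma_kernel /beta_kernel mulrCA ler_wpM2l ?powR_ge0 // powRN.
    rewrite ler_pdivlMr ?powR_gt0 ?addr_gt0 // mulrC.
    by have := leC x x0; rewrite mulr1.
  - exact: measurable_gamma_kernel.
  - apply: continuous0y_measurable.
    by apply: continuous0yM => //; exact: continuous0y_cst.
rewrite eint0yZ //; last exact: (continuous0y_measurable cb).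
- apply: lte_mul_pinfty; rewrite ?lee_fin //.
  by apply: eint0y_beta_fin; rewrite ?ltrDl.
- by move=> x _; exact: beta_kernel_ge0.
Qed.

(** Integration by parts with x^z e^(-x), which vanishes at both ends. *)
Lemma eint0y_gamma_rec z : 0 < z ->
  (z%:E * eint0y (gamma_kernel z) = eint0y (gamma_kernel (z + 1)))%E.
Proof.
move=> z0; rewrite -eint0yZ ?(ltW z0) //; last exact: measurable_gamma_kernel.
2: by move=> x _; exact: gamma_kernel_ge0.
transitivity (eint0y (gamma_kernel (z + 1)) + (0 - 0)%R%:E)%E;
  last by rewrite subrr adde0.
apply: (@eint0y_FTC _ (fun x => x `^ z * expR (- x))).
- move=> x x0; have d1 := is_derive1_powR z x0.
  have d2 : is_derive x 1 (fun x => expR (- x)) (- expR (- x)).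
    have := is_derive_expRN 1 x; rewrite mulr1 mulN1r.
    by under eq_fun do rewrite mulr1.
  have d := @is_deriveM _ _ _ _ _ _ _ _ d1 d2.
  apply: (is_derive_eq d); rewrite /GRing.scale /= /gamma_kernel addrK; ring.
- by move=> x _; rewrite mulr_ge0 ?gamma_kernel_ge0 ?ltW.
- by move=> x _; exact: gamma_kernel_ge0.
- by apply: continuous0yM; [exact: continuous0y_cst|exact: continuous0y_gamma_kernel].
- exact: continuous0y_gamma_kernel.
- apply: squeeze_cvgr (cvg_cst 0) (powR_cvg0 z0).
  near=> x; rewrite mulr_ge0 ?powR_ge0 ?expR_ge0 //= ler_piMr ?powR_ge0 //.
  rewrite -expR0 ler_expR oppr_le0 ltW //; near: x; exact: nbhs_right_gt.
- have [C C0 leC] := @powR_add1_le_expR R (z + 1) 1 ltr01.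
  have lim : C * (x + 1) `^ (- 1) @[x --> +oo] --> (0 : R).
    rewrite -[X in _ --> X](mulr0 C).
    by apply: cvgM; [exact: cvg_cst|exact: cvgy_powR_add1].
  apply: squeeze_cvgr (cvg_cst 0) lim.
  near=> x; have x0 : 0 < x by near: x; exact: nbhs_pinfty_gt.
  rewrite mulr_ge0 ?powR_ge0 ?expR_ge0 //= powRN ler_pdivlMr ?powR_gt0 ?addr_gt0 //.
  apply: le_trans (leC x x0); rewrite mulr1 mulrAC ler_wpM2r ?expR_ge0 //.
  rewrite powRD ?(gt_eqF (addr_gt0 x0 ltr01)) ?implybT // ler_wpM2r ?powR_ge0 //.
  by apply: ge0_ler_powR; rewrite ?nnegrE ?addr_ge0 ?lerDl // ltW.
Unshelve. all: by end_near. Qed.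

Lemma eint0y_gamma_scale z p : 0 < p ->
  (eint0y (fun x => x `^ (z - 1) * expR (- (x * p)))%R
   = (p `^ (- z))%:E * eint0y (gamma_kernel z))%E.
Proof.
move=> p0; rewrite (@eint0y_scale _ (gamma_kernel z) _ p0);
  last exact: continuous0y_gamma_kernel.
2: by move=> x _; exact: gamma_kernel_ge0.
have cf : continuous0y (fun x : R => p * gamma_kernel z (p * x)).
  apply: continuous0yM; first exact: continuous0y_cst.
  move=> x xD; apply: (@continuous_comp _ _ _ ( *%R p) (gamma_kernel z)).
    exact: mulrl_continuous.
  apply: continuous0y_gamma_kernel.
  by move: xD; rewrite !in_itv /= !andbT => x0; rewrite mulr_gt0.
rewrite -eint0yZ ?powR_ge0 //; last exact: (continuous0y_measurable cf).
- apply: eq_eint0y => x x0; rewrite /gamma_kernel powRM ?(ltW p0) ?(ltW x0) //.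
  rewrite !mulrA -[_ * p * _]mulrA (mulr_powR_sub1 z p0) powRN mulVf ?mul1r.
    by rewrite mulrC [p * x]mulrC mulrC.
  by rewrite gt_eqF ?powR_gt0.
- by move=> x _; rewrite mulr_ge0 ?gamma_kernel_ge0 ?ltW.
Qed.

End GammaIntegral.

Section Tonelli.
Context {R : realType}.
Local Open Scope classical_set_scope.
Local Open Scope ring_scope.
Local Notation mu := (@lebesgue_measure R).
Local Notation D := (`](0 : R), +oo[%classic).
Variable f : R * R -> R.
Hypotheses (mf : measurable_fun setT f) (f0 : forall z, 0 <= f z).

Let g : R * R -> \bar R := (EFin \o f) \_ (D `*` D).

Let mg : measurable_fun setT g.
Proof.
apply/(measurable_restrictT _ _).1; first exact: measurableX.
by apply/measurable_EFinP; exact: measurable_funTS.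
Qed.

Let g0 z : (0 <= g z)%E.
Proof. by rewrite /g patchE; case: ifP => // _; rewrite lee_fin. Qed.

Let gl : (fun x => \int[mu]_t g (x, t))%E = (fun x => eint0y (fun t => f (x, t))) \_ D.
Proof.
apply/funext => x; rewrite patchE; case: ifPn => xD.
- rewrite /eint0y [RHS]integral_mkcond; apply: eq_integral => t _.
  by rewrite /g !patchE in_setX xD.
- by rewrite integral0_eq // => t _; rewrite /g patchE in_setX (negbTE xD).
Qed.

Let gr : (fun t => \int[mu]_x g (x, t))%E = (fun t => eint0y (fun x => f (x, t))) \_ D.
Proof.
apply/funext => x; rewrite patchE; case: ifPn => xD.
- rewrite /eint0y [RHS]integral_mkcond; apply: eq_integral => t _.
  by rewrite /g !patchE in_setX xD andbT.
- by rewrite integral0_eq // => t _; rewrite /g patchE in_setX (negbTE xD) andbF.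
Qed.

Lemma measurable_eint0y : measurable_fun D (fun x => eint0y (fun t => f (x, t))).
Proof.
apply/(measurable_restrictT _ _).2 => //.
by rewrite -gl; exact: measurable_fun_fubini_tonelli_F.
Qed.

Lemma eint0y_tonelli : (\int[mu]_(x in D) eint0y (fun t => f (x, t))
  = \int[mu]_(t in D) eint0y (fun x => f (x, t)))%E.
Proof.
rewrite [LHS]integral_mkcond [RHS]integral_mkcond -gl -gr.
exact: fubini_tonelli.
Qed.

End Tonelli.

(** * Moments of the Tricomi weight *)

Section Moments.
Context {R : realType}.
Local Open Scope classical_set_scope.
Local Open Scope ring_scope.
Local Notation mu := (@lebesgue_measure R).
Local Notation D := (`](0 : R), +oo[%classic).
Implicit Types (a b c s z x t p : R).

Lemma eint0yE (f : R -> R) : (forall x, 0 < x -> 0 <= f x) ->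
  (eint0y f < +oo)%E -> eint0y f = (integral0y f)%:E.
Proof. by move=> f0 fy; rewrite fineK // ge0_fin_numE // eint0y_ge0. Qed.

Lemma GammaE z : 0 < z -> eint0y (gamma_kernel z) = (Gamma z)%:E.
Proof.
move=> z0; apply: eint0yE => [x _|]; first exact: gamma_kernel_ge0.
exact: eint0y_gamma_fin.
Qed.

Lemma GammaS z : 0 < z -> Gamma (z + 1) = z * Gamma z.
Proof.
move=> z0; apply: EFin_inj.
by rewrite EFinM -!GammaE ?addr_gt0 // eint0y_gamma_rec.
Qed.

Lemma Gamma_rising z k : 0 < z -> Gamma (z + k%:R) = rising z k * Gamma z.
Proof.
move=> z0; elim: k => [|k IHk]; first by rewrite addr0 rising0 mul1r.
rewrite -natr1 addrA GammaS; last by rewrite ltr_wpDr.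
by rewrite IHk risingS; ring.
Qed.

Definition beta_int c s : R := integral0y (beta_kernel c s).

Lemma beta_intE c s : 0 < c -> c < s ->
  eint0y (beta_kernel c s) = (beta_int c s)%:E.
Proof.
move=> c0 lt_cs; apply: eint0yE => [x _|]; first exact: beta_kernel_ge0.
exact: eint0y_beta_fin.
Qed.

Lemma beta_intS c s : 0 < c -> c < s ->
  s * beta_int c (s + 1) = (s - c) * beta_int c s.
Proof.
move=> c0 lt_cs; have lt_cs1 : c < s + 1 by rewrite (lt_trans lt_cs) ?ltrDl.
have := eint0y_beta_rec c0 lt_cs.
rewrite (beta_intE c0 lt_cs) (beta_intE c0 lt_cs1) -!EFinM -EFinD => -[E].
by rewrite mulrBl -E addrAC subrr add0r.
Qed.

Lemma beta_int_rising c b k : 0 < c -> 0 < b ->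
  beta_int c (c + b + k%:R) = rising b k / rising (c + b) k * beta_int c (c + b).
Proof.
move=> c0 b0; elim: k => [|k IHk]; first by rewrite addr0 !rising0 divr1 mul1r.
have s0 : 0 < c + b + k%:R by rewrite ltr_wpDr // addr_gt0.
apply: (mulfI (lt0r_neq0 s0)); rewrite -natr1 addrA beta_intS //; last first.
  by rewrite -addrA ltrDl ltr_wpDr.
rewrite IHk !risingS; field.
by rewrite rising_neq0 ?addr_gt0 //= gt_eqF.
Qed.

(** The integrand of Tricomi's function, with q = beta - alpha - 1. *)
Definition tricomi_kernel c q x t :=
  t `^ (c - 1) * (t + 1) `^ q * expR (- (t * x)).

Lemma tricomi_kernel_ge0 c q x t : 0 <= tricomi_kernel c q x t.
Proof. by rewrite !mulr_ge0 ?powR_ge0 ?expR_ge0. Qed.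

Lemma continuous0y_tricomi_kernel c q x : continuous0y (tricomi_kernel c q x).
Proof.
apply: continuous0yM; last exact: continuous0y_expRN.
by apply: continuous0yM; [exact: continuous0y_powR|exact: continuous0y_powR_add1].
Qed.

Lemma eint0y_tricomi c q x : 0 < c -> 0 < x ->
  eint0y (tricomi_kernel c q x) = (integral0y (tricomi_kernel c q x))%:E.
Proof.
move=> c0 x0; apply: eint0yE => [t _|]; first exact: tricomi_kernel_ge0.
have [C C0 leC] := powR_add1_le_expR (q + c + 1) x0.
have cb := @continuous0y_beta_kernel R c (c + 1).
apply: (@le_lt_trans _ _ (eint0y (fun t => C * beta_kernel c (c + 1) t)%R)).
  apply: eint0y_le => [t _|t t0||]; first exact: tricomi_kernel_ge0.
  - rewrite /tricomi_kernel /beta_kernel -mulrA [leRHS]mulrCA ler_wpM2l ?powR_ge0 //.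
    rewrite powRN ler_pdivlMr ?powR_gt0 ?addr_gt0 // mulrAC.
    rewrite -powRD ?(gt_eqF (addr_gt0 t0 ltr01)) ?implybT // addrA.
    exact: leC.
  - by apply: continuous0y_measurable; exact: continuous0y_tricomi_kernel.
  - apply: continuous0y_measurable.
    by apply: continuous0yM => //; exact: continuous0y_cst.
rewrite eint0yZ //; last exact: (continuous0y_measurable cb).
- apply: lte_mul_pinfty; rewrite ?lee_fin //.
  by apply: eint0y_beta_fin; rewrite ?ltrDl.
- by move=> t _; exact: beta_kernel_ge0.
Qed.

Definition tricomi_weight a b c x :=
  expR (- x) * x `^ a * integral0y (tricomi_kernel c (a - b + 1 - c - 1) x).

(** Every constant is pulled out: only the dependence on x of the weight matters
for orthogonality. *)
Lemma calWE a b c x : calW a b c x =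
  Gamma (c + b + 1) / (Gamma (a + 1) * Gamma (b + 1)) / Gamma c
  * tricomi_weight a b c x.
Proof.
rewrite /calW /tricomiU /tricomi_weight -!mulrA; congr (_ * (_ * _)).
by rewrite [RHS]mulrCA; congr (_ * _); rewrite mulrCA.
Qed.

Section FixedParameters.
Variables (a b c : R) (k : nat).
Hypotheses (a1 : 0 < a + 1) (b1 : 0 < b + 1) (c0 : 0 < c).

Let q := a - b + 1 - c - 1.

(* Merging x^k and x^a into one real power makes the integrand nonnegative on the
   whole plane. *)
Let F (z : R * R) : R := z.1 `^ (a + k%:R) * expR (- z.1)
  * (z.2 `^ (c - 1) * (z.2 + 1) `^ q * expR (- (z.2 * z.1))).

Let mF : measurable_fun setT F.
Proof.
have mpow (h : R * R -> R) (e : R) : measurable_fun setT h ->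
    measurable_fun setT (fun w => h w `^ e).
  by move=> mh; apply: (measurableT_comp (measurable_powR e) mh).
have mexp (h : R * R -> R) : measurable_fun setT h ->
    measurable_fun setT (fun w => expR (- h w)).
  move=> mh; apply: (measurableT_comp (@measurable_expR R)).
  exact: measurableT_comp.
have m1 : measurable_fun [set: R * R] fst by exact: measurable_fst.
have m2 : measurable_fun [set: R * R] snd by exact: measurable_snd.
apply: measurable_funM; first by apply: measurable_funM; [exact: mpow|exact: mexp].
apply: measurable_funM; last by apply: mexp; exact: measurable_funM.
apply: measurable_funM; first exact: mpow.
by apply: mpow; exact: measurable_funD.
Qed.

Let F0 (w : R * R) : 0 <= F w.
Proof. by rewrite !mulr_ge0 ?powR_ge0 ?expR_ge0. Qed.

Let inner_t x : 0 < x ->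
  eint0y (fun t => F (x, t)) = (x ^+ k * tricomi_weight a b c x)%:E.
Proof.
move=> x0; rewrite (_ : _ * _ = x `^ (a + k%:R) * expR (- x)
    * integral0y (tricomi_kernel c q x)); last first.
  rewrite powRD ?(gt_eqF x0) ?implybT // powR_mulrn ?ltW //.
  by rewrite /tricomi_weight -/q; ring.
rewrite EFinM -eint0y_tricomi // -eint0yZ //.
- by rewrite mulr_ge0 ?powR_ge0 ?expR_ge0.
- by move=> t _; exact: tricomi_kernel_ge0.
- by apply: continuous0y_measurable; exact: continuous0y_tricomi_kernel.
Qed.

Let inner_x t : 0 < t -> eint0y (fun x => F (x, t))
  = (Gamma (a + 1 + k%:R) * beta_kernel c (c + (b + 1) + k%:R) t)%:E.
Proof.
move=> t0; have t1 : 0 < t + 1 by rewrite addr_gt0.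
have ak : 0 < a + 1 + k%:R by rewrite ltr_wpDr.
have Hq : (t + 1) `^ (- (c + (b + 1) + k%:R))
    = (t + 1) `^ q * (t + 1) `^ (- (a + 1 + k%:R)).
  rewrite -powRD ?(gt_eqF t1) ?implybT //; congr powR; rewrite /q; ring.
pose f x := x `^ (a + 1 + k%:R - 1) * expR (- (x * (t + 1))).
have cf : continuous0y f.
  by apply: continuous0yM; [exact: continuous0y_powR|exact: continuous0y_expRN].
transitivity (eint0y (fun x => t `^ (c - 1) * (t + 1) `^ q * f x)).
  apply: eq_eint0y => x _; rewrite /F /f /=.
  have -> : a + 1 + k%:R - 1 = a + k%:R by ring.
  have -> : - (x * (t + 1)) = - x + - (t * x) by ring.
  by rewrite expRD; ring.
rewrite eint0yZ ?mulr_ge0 ?powR_ge0 //.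
- rewrite eint0y_gamma_scale // GammaE // -!EFinM; congr EFin.
  by rewrite /beta_kernel Hq; ring.
- by move=> x _; rewrite mulr_ge0 ?powR_ge0 ?expR_ge0.
- exact: continuous0y_measurable.
Qed.

(** Integrating over x first gives Gamma(a + 1 + k) (t + 1)^(-(a + 1 + k)), and this
power of t + 1 completes the integrand over t to a Beta kernel. *)
Lemma eint0y_tricomi_weight :
  eint0y (fun x => x ^+ k * tricomi_weight a b c x)
  = (Gamma (a + 1 + k%:R) * beta_int c (c + (b + 1) + k%:R))%:E.
Proof.
have ak : 0 < a + 1 + k%:R by rewrite ltr_wpDr.
transitivity (\int[mu]_(x in D) eint0y (fun t => F (x, t)))%E.
  apply: eq_integral => x /set_mem /=; rewrite in_itv /= andbT => x0.
  by rewrite inner_t.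
rewrite eint0y_tonelli //.
transitivity (eint0y (fun t =>
    Gamma (a + 1 + k%:R) * beta_kernel c (c + (b + 1) + k%:R) t)).
  apply: eq_integral => x /set_mem /=; rewrite in_itv /= andbT => x0.
  by rewrite inner_x.
have ltc : c < c + (b + 1) + k%:R by rewrite -addrA ltrDl ltr_wpDr.
rewrite eint0yZ.
- by rewrite beta_intE // EFinM.
- by rewrite -lee_fin -GammaE // eint0y_ge0 // => x _; exact: gamma_kernel_ge0.
- by move=> t _; exact: beta_kernel_ge0.
- by apply: continuous0y_measurable; exact: continuous0y_beta_kernel.
Qed.

Lemma tricomi_weight_ge0 x : 0 <= tricomi_weight a b c x.
Proof.
rewrite !mulr_ge0 ?powR_ge0 ?expR_ge0 //.
by apply: Rintegral_ge0 => t _; exact: tricomi_kernel_ge0.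
Qed.

Lemma integrable_tricomi_weight :
  mu.-integrable D (EFin \o (fun x => x ^+ k * tricomi_weight a b c x)).
Proof.
apply/integrableP; split.
  apply: eq_measurable_fun (measurable_eint0y mF F0) => x.
  by move=> /set_mem /=; rewrite in_itv /= andbT => x0; rewrite inner_t.
apply: (@le_lt_trans _ _ (eint0y (fun x => x ^+ k * tricomi_weight a b c x))).
  rewrite le_eqVlt; apply/orP; left; apply/eqP; apply: eq_integral => x.
  move=> /set_mem /=; rewrite in_itv /= andbT => x0.
  by rewrite ger0_norm // mulr_ge0 ?tricomi_weight_ge0 // exprn_ge0 // ltW.
by rewrite eint0y_tricomi_weight ltry.
Qed.

End FixedParameters.

Lemma integrable_calW a b c k : -1 < a -> -1 < b -> 0 < c ->
  mu.-integrable D (EFin \o (fun x => x ^+ k * calW a b c x)).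
Proof.
move=> a1 b1 c0; have a0 : 0 < a + 1 by rewrite -ltrBlDr sub0r.
have b0 : 0 < b + 1 by rewrite -ltrBlDr sub0r.
pose K0 := Gamma (c + b + 1) / (Gamma (a + 1) * Gamma (b + 1)) / Gamma c.
rewrite (_ : EFin \o _ = fun x => (K0%:E * (x ^+ k * tricomi_weight a b c x)%:E)%E).
  by apply: integrableZl; [exact: measurable_itv|exact: integrable_tricomi_weight].
by apply/funext => x /=; rewrite calWE -EFinM; congr EFin; rewrite mulrCA.
Qed.

Lemma moment_calW a b c : -1 < a -> -1 < b -> 0 < c ->
  exists K : R, forall k, integral0y (fun x => x ^+ k * calW a b c x)
    = K * (rising (a + 1) k * rising (b + 1) k / rising (c + b + 1) k).
Proof.
move=> a1 b1 c0; have a0 : 0 < a + 1 by rewrite -ltrBlDr sub0r.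
have b0 : 0 < b + 1 by rewrite -ltrBlDr sub0r.
pose K0 := Gamma (c + b + 1) / (Gamma (a + 1) * Gamma (b + 1)) / Gamma c.
exists (K0 * (Gamma (a + 1) * beta_int c (c + (b + 1)))) => k.
transitivity (K0 * integral0y (fun x => x ^+ k * tricomi_weight a b c x)).
  rewrite /integral0y -RintegralZl //; last exact: integrable_tricomi_weight.
  by apply: eq_Rintegral => x _; rewrite calWE mulrCA.
rewrite [integral0y _](_ : _ = Gamma (a + 1 + k%:R)
    * beta_int c (c + (b + 1) + k%:R)); last first.
  by rewrite /integral0y /Rintegral -/(eint0y _) eint0y_tricomi_weight.
rewrite Gamma_rising // beta_int_rising // -addrA; ring.
Qed.

End Moments.

(** * The differential equation *)

Theorem theorem3p3 (R : realType) (a b c : R)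
    (ha : -1 < a) (hb : -1 < b) (hc : Num.max 0 (a - b) < c)
    (d : nat) (hd : (d <= 1)%N)
    (P : nat -> {poly R}) (hmonic : forall n : nat, P n \is monic)
    (hP : two_orthogonal (calWbar d a b c) P) (n : nat) (x : R) :
  x ^+ 2 * derive1n 3 (horner (P n)) x
  - x * phi a b x * derive1n 2 (horner (P n)) x
  + psi d n a b c x * derive1n 1 (horner (P n)) x
  + n%:R * epsilon d n b c * (P n).[x] = 0.
Proof.
have c0 : 0 < c by apply: le_lt_trans hc; rewrite le_max lexx.
have u0 : 0 < a + 1 by rewrite -ltrBlDr sub0r.
have v0 : 0 < b + 1 by rewrite -ltrBlDr sub0r.
set e := epsilon d n b c.
have e0 : 0 < e by rewrite /e /epsilon ltr_wpDr // -addrA addr_gt0.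
(* The parameter c of the two weights; they are indexed by the parity of j, so
   that [l] enumerates the orthogonality conditions in the order 2k, 2k + 1. *)
pose ci (i : bool) : R := if i then c + 1 - d%:R else c + d%:R.
have ci0 i : 0 < ci i.
  case: i; rewrite /ci; last by rewrite ltr_wpDr.
  by rewrite -addrA ltr_wpDr // subr_ge0 lern1.
pose wi i := calW a b (ci i).
pose l j : {scalar {poly R}} := moment_functional (power_moment (wi (odd j))) j./2.
have lE i k p : moment (wi i) k p = moment_functional (power_moment (wi i)) k p.
  by apply: momentE => j; exact: integrable_calW.
case: hP => szP orthP.
have lP0 j m : (j < m)%N -> l j (P m) = 0.
  move=> lt_jm; rewrite /l /= -lE; have [h0 _ h1 _] := orthP j./2 m.
  by have := odd_double_half j; case: (odd j) => /= Ej; [apply: h1|apply: h0]; lia.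
have lP j : l j (P j) <> 0.
  rewrite /l /= -lE; have [_ h0 _ h1] := orthP j./2 j.
  by have := odd_double_half j; case: (odd j) => /= Ej; [apply: h1|apply: h0]; lia.
have PQ : P n = hyp_poly e (a + 1) (b + 1) n.
  apply: (monic_orthogonal_unique szP (hmonic n) _ _ lP0 lP).
  - exact: monic_hyp_poly.
  - exact: size_hyp_poly.
  move=> j lt_jn; rewrite /l /=.
  have [K momE] := @moment_calW R a b (ci (odd j)) ha hb (ci0 _).
  have g0 : 0 < ci (odd j) + b + 1 by rewrite -addrA addr_gt0.
  (* The excess r of e over the moment parameter is floor((n + d) / 2) minus s. *)
  pose s := if odd j then (1 - d)%N else d.
  have eE : e = ci (odd j) + b + 1 + ((n + d) %/ 2 - s)%N%:R.
    have le_s : (s <= (n + d) %/ 2)%N.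
      by rewrite /s; have := odd_double_half j; case: (odd j) => /=; lia.
    rewrite natrB // /e /epsilon /ci /s; case: (odd j); last by ring.
    by rewrite natrB //; ring.
  rewrite eE; apply: (moment_functional_hyp_poly_eq0 g0 u0 v0 _ _ momE).
  - by rewrite /s; have := odd_double_half j; case: (odd j) => /=; lia.
  - by rewrite /s; have := odd_double_half j; case: (odd j) => /=; lia.
have ode := @hypergeometric_ode _ a b e n%:R (P n).
have nE : n%:R - 1 - e = ((n + 1 - d) %/ 2)%:R - (c + b + 2).
  have -> : n%:R = ((n + 1 - d) %/ 2)%:R + ((n + d) %/ 2)%:R :> R.
    by rewrite -natrD; congr _%:R; lia.
  by rewrite /e /epsilon; ring.
have := congr1 (horner^~ x) (ode _); rewrite horner0 => <-.
  rewrite !derive1nS derive1n0 -!derivE /psi /phi -nE !hornerE; ring.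
by move=> j; rewrite PQ !coef_hyp_poly hyp_coef_rec.
Qed.
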